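(* Let $X$ be a Tychonoff space and let $\beta X$ be its Čech–Stone compactification. The following conditions are equivalent: (A) $X$ is projectively Hurewicz; (B) for any set $F \subseteq \beta X \setminus X$ which is a countable union of zero-sets in $\beta X$, there exists a $G_\delta$-subset $G$ of $\beta X$ such that $F \subseteq G \subseteq \beta X \setminus X$.
   Context: All spaces are Tychonoff (completely regular Hausdorff). $X$ is regarded as a subspace of its Čech–Stone compactification $\beta X$. A topological space $Y$ is Hurewicz (has the Hurewicz property) if for every sequence $(\mathscr{U}_n)_{n\in\omega}$ of open covers of $Y$ there is a sequence $(\mathscr{V}_n)_{n\in\omega}$ such that for every $n$, $\mathscr{V}_n$ is a finite subfamily of $\mathscr{U}_n$, and every point of $Y$ belongs to $\bigcup\mathscr{V}_n$ for all but finitely many $n$. A space $X$ is projectively Hurewicz if every separable metrizable continuous image of $X$ is Hurewicz. A subset $A$ of a space $Z$ is a zero-set in $Z$ if there is a continuous map $f: Z\to[0,1]$ with $A=f^{-1}(0)$. *)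

(* Defs.v *)
From HB Require Import structures.
From mathcomp Require Import all_boot all_order all_algebra.
From mathcomp Require Import all_classical all_reals all_analysis.
From mathcomp Require Import borel_hierarchy.

Set Implicit Arguments.
Unset Strict Implicit.
Unset Printing Implicit Defensive.

Import Order.TTheory GRing.Theory Num.Theory.
Import numFieldNormedType.Exports.

Local Open Scope classical_set_scope.
Local Open Scope ring_scope.

Definition tychonoff_space (X : topologicalType) : Prop :=
  hausdorff_space X /\ completely_regular_space X.

(* The first equation says that the topology of S is the one induced by e. *)
Definition embedding (S T : topologicalType) (e : S -> T) : Prop :=
  (@open S = [set e @^-1` B | B in @open T]) /\ injective e.

Definition homeomorphism (S T : topologicalType) (h : S -> T) : Prop :=
  embedding h /\ range h = [set: T].

(* A space B with a map e : X -> B is a Cech-Stone compactification of X when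
   it is a Hausdorff compactification of X to which every continuous map from X
   into a compact Hausdorff space extends.  Such a pair is unique up to a
   homeomorphism fixing X; its existence is stone_cech_exists below. *)
Definition stone_cech_compactification (X B : topologicalType) (e : X -> B)
    : Prop :=
  [/\ compact [set: B], hausdorff_space B, embedding e, dense (range e) &
    forall (K : topologicalType) (g : X -> K),
      compact [set: K] -> hausdorff_space K -> continuous g ->
      exists2 h : B -> K, continuous h & forall x, h (e x) = g x].

Definition separable (T : topologicalType) : Prop :=
  exists2 D : set T, countable D & dense D.

Definition metrizable (R : realType) (T : topologicalType) : Prop :=
  exists (M : metricType R) (h : T -> M), homeomorphism h.

Definition open_cover (T : topologicalType) (U : set (set T)) : Prop :=
  U `<=` open /\ \bigcup_(A in U) A = [set: T].

Definition hurewicz (T : topologicalType) : Prop :=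
  forall U : nat -> set (set T), (forall n, open_cover (U n)) ->
  exists V : nat -> set (set T),
    (forall n, finite_set (V n) /\ V n `<=` U n) /\
    (forall x : T, \forall n \near \oo, (\bigcup_(A in V n) A) x).

Definition projectively_hurewicz (R : realType) (X : topologicalType) : Prop :=
  forall (Y : topologicalType) (f : X -> Y),
    continuous f -> range f = [set: Y] ->
    separable Y -> metrizable R Y -> hurewicz Y.

Definition zero_set (R : realType) (T : topologicalType) (A : set T) : Prop :=
  exists f : T -> R,
    [/\ continuous f, forall x, 0 <= f x <= 1 & A = f @^-1` [set 0]].

Definition countable_union_of_zero_sets (R : realType) (T : topologicalType)
    (F : set T) : Prop :=
  exists Z : set (set T),
    [/\ countable Z, Z `<=` @zero_set R T & F = \bigcup_(A in Z) A].

(* The closure of the image of X in the cube of all continuous X -> [0, 1] is a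
   Cech-Stone compactification of X. *)
Lemma prod_continuous (I : choiceType) (T : topologicalType)
    (U : I -> topologicalType) (f : T -> prod_topology U) :
  (forall i, continuous (fun x => f x i)) -> continuous f.
Proof.
move=> cf x; apply/cvg_sup => i; move: x.
apply/(@continuousP _ (initial_topology (@^~ i))) => A [B oB <-].
by rewrite -comp_preimage; move/continuousP : (cf i); apply.
Qed.

Lemma initial_compact (S : choiceType) (T : topologicalType) (f : S -> T) :
  compact (range f) -> compact [set: initial_topology f].
Proof.
move=> cf F FF _.
have FR : F (f @^-1` range f) by apply: filterS filterT => s _; exists s.
have [t [[s _ <-] cs]] := cf (f @ F) _ FR.
exists s; split=> // A B FA [_ [[C oC <-] /= Cs] CB].
have [_ [[s' As' <-] Cs']] : ((f @` A) `&` C) !=set0.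
  have FA' : F (f @^-1` (f @` A)) by apply: filterS FA => u Au; exists u.
  by apply: cs => //; exact: open_nbhs_nbhs.
by exists s'; split=> //; exact: CB.
Qed.

Lemma initial_hausdorff (S : choiceType) (T : topologicalType) (f : S -> T) :
  hausdorff_space T -> injective f -> hausdorff_space (initial_topology f).
Proof.
move=> hT fi p q pq; apply/fi/hT => A B Ap Bq.
have [r [Ar Br]] : (f @^-1` A `&` f @^-1` B) !=set0.
  by apply: pq; [exact: (@initial_continuous _ _ f p)|
                 exact: (@initial_continuous _ _ f q)].
by exists (f r).
Qed.

Section stone_cech_existence.
Context (R : realType).

Definition unit_funs (X : topologicalType) : set (X -> R) :=
  [set f : X -> R | continuous f /\ forall x, 0 <= f x <= 1].

Arguments unit_funs : clear implicits.

Definition cube (X : topologicalType) : topologicalType :=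
  prod_topology (fun _ : set_type (unit_funs X) => R^o : topologicalType).

Definition cube_eval (X : topologicalType) : X -> cube X :=
  join_product (fun f : set_type (unit_funs X) => \val f).

Lemma unit_funP (X : topologicalType) (f : set_type (unit_funs X)) :
  unit_funs X (\val f).
Proof. exact: set_valP. Qed.

Lemma cube_eval_continuous (X : topologicalType) : continuous (@cube_eval X).
Proof. by apply: prod_continuous => i; have [] := unit_funP i. Qed.

Lemma proj_cube (X : topologicalType) i :
  continuous (fun p : cube X => p i).
Proof. exact: (@proj_continuous _ (fun _ => R^o : topologicalType) i). Qed.

Lemma cube_hausdorff X : hausdorff_space (cube X).
Proof. by apply: hausdorff_product => _; exact: Rhausdorff. Qed.

Lemma cube_eval_sep (X : topologicalType) : completely_regular_space X ->
  separate_points_from_closed (fun f : set_type (unit_funs X) => \val f).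
Proof.
move=> crX U x cU Ux.
have /(@uniform_separatorP _ R)[f [cf f01 fx fU]] := crX x U cU Ux.
have uf : unit_funs X f.
  by split=> // y; have := f01 (f y) (imageT f y); rewrite /= in_itv.
exists (SigSub (mem_set uf)) => /=.
have -> : f x = 0 by apply: fx; exists x.
move=> /(closureS fU); rewrite -(closure_id _).1; last first.
  by apply: (accessible_closed_set1 (hausdorff_accessible (@Rhausdorff R))).
by move=> /eqP; rewrite eq_sym oner_eq0.
Qed.

Lemma cube_eval_inj (X : topologicalType) :
  tychonoff_space X -> injective (@cube_eval X).
Proof.
move=> [hX crX] x y; apply: (join_product_inj (cube_eval_sep crX));
  rewrite ?inE//.
exact: hausdorff_accessible.
Qed.

Lemma cube_eval_open (X : topologicalType) : tychonoff_space X ->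
  @open X = [set (@cube_eval X) @^-1` B | B in @open (cube X)].
Proof.
move=> tX; have [hX crX] := tX.
apply: (join_product_initial (cube_eval_sep crX)).
  by move=> i; have [] := unit_funP i.
by move=> x y _ _; exact: cube_eval_inj.
Qed.

Definition stone_cech (X : topologicalType) : set (cube X) :=
  closure (range (@cube_eval X)).

Arguments stone_cech : clear implicits.

Lemma compact_stone_cech X : compact (stone_cech X).
Proof.
have cc : compact [set p : cube X | forall i, `[0, 1]%classic (p i)].
  have T := @tychonoff (set_type (unit_funs X))
    (fun _ => R^o : topologicalType) (fun _ => `[0, 1]%classic).
  apply: T => _.
  exact: (@segment_compact R 0 1).
have clc : closed [set p : cube X | forall i, `[0, 1]%classic (p i)].
  exact: (compact_closed (@cube_hausdorff X) cc).
apply: (@subclosed_compact (cube X) _ _ _ cc); first exact: closed_closure.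
rewrite [X in _ `<=` X](closure_id _).1//; apply: closureS => _ [x _ <-] i /=.
by have [_ /(_ x)] := unit_funP i; rewrite in_itv.
Qed.

Lemma compact_tychonoff (K : topologicalType) :
  compact [set: K] -> hausdorff_space K -> tychonoff_space K.
Proof.
move=> cK hK; split=> //; apply: (@normal_completely_regular R).
  exact: compact_normal.
exact: hausdorff_accessible.
Qed.

Lemma stone_cech_exists (X : topologicalType) : tychonoff_space X ->
  exists (B : topologicalType) (e : X -> B), stone_cech_compactification e.
Proof.
move=> tX.
have eb x : cube_eval x \in stone_cech X
  by apply/mem_set/subset_closure; exists x.
pose e (x : X) : set_type (stone_cech X) := SigSub (eb x).
exists (set_type (stone_cech X)), e; split.
- apply: initial_compact.
  suff -> : range (@set_val (cube X) (stone_cech X)) = stone_cech X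
    by exact: compact_stone_cech.
  apply/seteqP; split=> [_ [p _ <-]|p bp]; first exact: set_valP.
  by exists (SigSub (mem_set bp)).
- by apply: initial_hausdorff; [exact: cube_hausdorff|exact: val_inj].
- split; last by move=> x y /(congr1 val); exact: cube_eval_inj.
  rewrite cube_eval_open//; apply/seteqP; split=> [_ [B oB <-]|].
    by exists (set_val @^-1` B) => //; exists B.
  by move=> _ [_ [B oB <-] <-]; exists B.
- move=> O [p Op] [B oB BO]; move: Op; rewrite -BO => Op.
  have [_ [[x _ <-] Bx]] : (range (@cube_eval X) `&` B) !=set0.
    by have := set_valP p; apply; exact: open_nbhs_nbhs.
  by exists (e x); split=> //; exists x.
move=> K g cK hK cg.
have tK := compact_tychonoff cK hK.
have gf (k : set_type (unit_funs K)) : unit_funs X (\val k \o g).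
  have [ck k01] := unit_funP k; split=> [x|x]; last exact: k01.
  by apply: continuous_comp; [exact: cg|exact: ck].
pose Phi (p : cube X) : cube K := fun k => p (SigSub (mem_set (gf k))).
have cPhi : continuous Phi by apply: prod_continuous => k; exact: proj_cube.
have cl A : closed A -> closed ((@cube_eval K) @` A).
  move=> cA; apply: compact_closed; first exact: cube_hausdorff.
  apply: continuous_compact.
    by apply: continuous_subspaceT; exact: cube_eval_continuous.
  exact: (subclosed_compact cA cK).
have bPhi (p : set_type (stone_cech X)) : exists k, cube_eval k = Phi (\val p).
  suff [k _ <-] : range (@cube_eval K) (Phi (\val p)) by exists k.
  have : closed (Phi @^-1` range (@cube_eval K)).
    by move/continuous_closedP : cPhi; apply; exact: cl closedT.
  move/closure_id => H; suff : (Phi @^-1` range (@cube_eval K)) (\val p) by [].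
  rewrite H; apply: closureS (set_valP p) => _ [x _ <-].
  by exists (g x).
pose h p := projT1 (cid (bPhi p)).
have hE p : cube_eval (h p) = Phi (\val p) := projT2 (cid (bPhi p)).
exists h; last by move=> x; apply: (cube_eval_inj tK); rewrite hE.
apply/continuous_closedP => A cA.
have -> : h @^-1` A = set_val @^-1` (Phi @^-1` ((@cube_eval K) @` A)).
  apply/seteqP; split=> [p Ap|p [k Ak]]; first by exists (h p).
  move=> kE; have hk : h p = k by apply: (cube_eval_inj tK); rewrite hE.
  by rewrite /preimage/= hk.
have cv : continuous (set_val : set_type (stone_cech X) -> cube X).
  exact: initial_continuous.
move/continuous_closedP : cv; apply.
by move/continuous_closedP : cPhi; apply; exact: cl.
Qed.

End stone_cech_existence.

(* Main.v *)
Require Import Defs.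
From HB Require Import structures.
From mathcomp Require Import all_boot all_order all_algebra.
From mathcomp Require Import all_classical all_reals all_analysis.
From mathcomp Require Import borel_hierarchy.
From mathcomp Require Import lra.

(* If X is projectively Hurewicz and F is the union of zero-sets Z_k, let g_k be
   a function on bX whose zero-set is Z_0 \/ .. \/ Z_k.  The image of X in the
   space of sequences under x |-> (g_k x)_k is separable metrizable, and the
   Hurewicz property for the covers {y | y_k > 1/(m+1)}, m in nat, yields m_k
   such that every x in X has g_k x > 1/(m_k+1) for almost all k.  Then G is the
   set of the p with g_k p < 1/(m_k+1) for infinitely many k.

   Conversely, let (U_n) be open covers of a separable metrizable image Y of X.
   Extend to bX the functions phi_ij that are positive exactly over the ball of
   radius 1/(j+1) around the i-th point of a dense sequence of Y.  Let Z_n be the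
   common zero-set of those phi_ij whose ball lies in a member of U_n; it misses
   X.  If G is as in (B) for the union of the Z_n, its complement is an increasing
   union of compact sets C_n containing X and missing every Z_m.  By compactness
   C_n is covered by finitely many of the sets phi_ij > 0 chosen for U_n, which
   gives the finite subfamily of U_n. *)

Set Implicit Arguments.
Unset Strict Implicit.
Unset Printing Implicit Defensive.
Import Order.TTheory GRing.Theory Num.Theory.
Import numFieldNormedType.Exports.
Local Open Scope classical_set_scope.
Local Open Scope ring_scope.

(** * A metric on sequences in the unit interval *)

Section seq_dist.
Context {R : realType}.
Implicit Types u v w : nat -> R.

Definition unit_seq u := forall k, 0 <= u k <= 1.

(** The weights [1/(k+1)] tend to 0, so that on sequences in the unit interval this metric induces
    the product topology. *)
Definition seq_dist u v : R := sup (range (fun k => `|u k - v k| / k.+1%:R)).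

Lemma seq_dist_le u v c :
  (forall k, `|u k - v k| / k.+1%:R <= c) -> seq_dist u v <= c.
Proof.
move=> h; apply: ge_sup; first by exists (`|u 0 - v 0| / 1%:R); exists 0%N.
by move=> _ [k _ <-].
Qed.

Lemma unit_seq_dist u v k : unit_seq u -> unit_seq v -> `|u k - v k| <= 1.
Proof.
by move=> /(_ k)/andP[u0 u1] /(_ k)/andP[v0 v1]; rewrite ler_norml; lra.
Qed.

Lemma le_seq_dist u v k : unit_seq u -> unit_seq v ->
  `|u k - v k| / k.+1%:R <= seq_dist u v.
Proof.
move=> uu uv; apply: ub_le_sup; last by exists k.
exists 1 => _ [j _ <-]; rewrite ler_pdivrMr ?ltr0n// mul1r.
by rewrite (le_trans (unit_seq_dist _ uu uv))// ler1n.
Qed.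

Lemma seq_distxx u : seq_dist u u = 0.
Proof.
have u0 k : `|u k - u k| / k.+1%:R = 0 by rewrite subrr normr0 mul0r.
rewrite /seq_dist -[RHS](sup1 (0 : R)); congr sup.
by apply/seteqP; split=> [_ [k _ <-]|_ ->]; [exact: u0|exists 0%N].
Qed.

Lemma seq_dist_eq0 u v : unit_seq u -> unit_seq v -> seq_dist u v = 0 -> u = v.
Proof.
move=> uu uv uv0; apply/funext => k; apply/eqP; rewrite -subr_eq0 -normr_le0.
have := le_seq_dist k uu uv.
by rewrite uv0 ler_pdivrMr ?ltr0n// mul0r.
Qed.

Lemma seq_distC u v : seq_dist u v = seq_dist v u.
Proof.
rewrite /seq_dist; congr sup; apply: eq_imagel => k _.
by rewrite distrC.
Qed.

Lemma seq_dist_triangle v u w : unit_seq u -> unit_seq v -> unit_seq w ->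
  seq_dist u w <= seq_dist u v + seq_dist v w.
Proof.
move=> uu uv uw; apply: seq_dist_le => k.
apply: le_trans (lerD (le_seq_dist k uu uv) (le_seq_dist k uv uw)).
by rewrite -mulrDl ler_wpM2r ?invr_ge0// ler_distD.
Qed.

Lemma seq_dist_ge0 u v : unit_seq u -> unit_seq v -> 0 <= seq_dist u v.
Proof.
by move=> uu uv; apply: le_trans (le_seq_dist 0 uu uv); rewrite divr_ge0.
Qed.

(* The tail k >= n of the supremum is at most 1 / (n + 1). *)
Lemma seq_dist_le_prefix u v n c : unit_seq u -> unit_seq v ->
  n.+1%:R^-1 <= c -> (forall k, (k < n)%N -> `|u k - v k| <= c) ->
  seq_dist u v <= c.
Proof.
move=> uu uv nc uvc; apply: seq_dist_le => k.
have c0 : 0 <= c by rewrite (le_trans _ nc)// invr_ge0.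
have [kn|nk] := ltnP k n.
  rewrite ler_pdivrMr ?ltr0n// (le_trans (uvc k kn))//.
  by rewrite ler_peMr// ler1n.
apply: le_trans nc; rewrite ler_pdivrMr ?ltr0n//.
rewrite (le_trans (unit_seq_dist k uu uv))// mulrC ler_pdivlMr ?ltr0n// mul1r.
by rewrite ler_nat.
Qed.

Lemma seq_dist_near (T : topologicalType) (phi : T -> nat -> R) (x : T) eps :
  (forall t, unit_seq (phi t)) -> (forall k, continuous (phi ^~ k)) ->
  0 < eps -> \forall y \near x, seq_dist (phi x) (phi y) <= eps.
Proof.
move=> phi1 cphi eps0.
have [n] := ltr_add_invr eps0; rewrite add0r => neps.
(* Only the coordinates below [n] matter, and finitely many neighbourhoods can be intersected. *)
have : \forall y \near x, forall k, (k < n)%N -> `|phi x k - phi y k| <= eps.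
  elim: n {neps} => [|n IHn]; first exact: nearW.
  have cn : \forall y \near x, `|phi x n - phi y n| <= eps.
    by move: eps eps0 {IHn}; apply/cvgrPdist_le; exact: cphi.
  apply: filterS2 IHn cn => y IHy yn k.
  by rewrite ltnS leq_eqVlt => /predU1P[->//|]; exact: IHy.
apply: filterS => y xy; exact: seq_dist_le_prefix (ltW neps) xy.
Qed.

Lemma seq_dist_continuous (T : topologicalType) (phi : T -> nat -> R) u :
  (forall t, unit_seq (phi t)) -> (forall k, continuous (phi ^~ k)) ->
  unit_seq u -> continuous (fun t => seq_dist u (phi t)).
Proof.
move=> phi1 cphi uu x; apply/cvgrPdist_le => eps eps0.
apply: filterS (seq_dist_near x phi1 cphi eps0) => y xy.
have := seq_dist_triangle (v := phi x) uu (phi1 x) (phi1 y).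
have := seq_dist_triangle (v := phi y) uu (phi1 y) (phi1 x).
by rewrite (seq_distC (phi y)) ler_norml; lra.
Qed.

End seq_dist.

(** The distance from the zero sequence to [(f k t)_k] is continuous in [t] and vanishes exactly
    when every [f k t] does. *)
Lemma zero_set_bigcap (R : realType) (T : topologicalType) (A : nat -> set T) :
  (forall k, zero_set R (A k)) -> zero_set R (\bigcap_k A k).
Proof.
move=> /(_ _)/cid-/all_sig[f fA].
have f1 t : unit_seq (f ^~ t) by move=> k; have [_ ->] := fA k.
have u0 : unit_seq (cst 0 : nat -> R) by move=> k; rewrite lexx ler01.
exists (fun t => seq_dist (cst 0) (f ^~ t)); split.
- by apply: (seq_dist_continuous (phi := fun t => f ^~ t)) => // k; have [] := fA k.
- move=> t; rewrite seq_dist_ge0//=; apply: seq_dist_le => k.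
  rewrite ler_pdivrMr ?ltr0n// mul1r.
  by rewrite (le_trans (unit_seq_dist _ u0 (f1 t)))// ler1n.
- apply/seteqP; split=> [t At|t /= /(seq_dist_eq0 u0 (f1 t)) ft k _].
    rewrite /preimage/= (_ : f ^~ t = cst 0) ?seq_distxx//.
    by apply/funext => k; have [_ _ fk] := fA k; have := At k I; rewrite fk.
  by have [_ _ ->] := fA k; have /esym := congr1 (@^~ k) ft.
Qed.

(** * Images in the sequence space as separable metric spaces *)

Section seq_image.
Context {R : realType} {T : Type} (phi : T -> nat -> R).

(* The proof argument is unused in the body; it makes the metric instance below
   available on the type. *)
Definition seq_image of forall t, unit_seq (phi t) := set_type (range phi).

Context (phi1 : forall t, unit_seq (phi t)).

Local Notation Y := (seq_image phi1).

HB.instance Definition _ := Choice.on Y.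

Definition seq_image_dist (y z : Y) := seq_dist (val y) (val z).

Lemma seq_image_unit (y : Y) : unit_seq (val y).
Proof. by have [t _ <-] := set_valP y. Qed.

Let distxx y : seq_image_dist y y = 0. Proof. exact: seq_distxx. Qed.

Let dist_eq0 y z : seq_image_dist y z = 0 -> y = z.
Proof.
by move=> yz; apply/val_inj/(seq_dist_eq0 _ _ yz); exact: seq_image_unit.
Qed.

Let distC y z : seq_image_dist y z = seq_image_dist z y.
Proof. exact: seq_distC. Qed.

Let dist_triangle z y w :
  seq_image_dist y w <= seq_image_dist y z + seq_image_dist z w.
Proof. by apply: seq_dist_triangle; exact: seq_image_unit. Qed.

HB.instance Definition _ :=
  isMetric.Build R Y distxx dist_eq0 distC dist_triangle.

End seq_image.

(** Started anywhere in a fiber of [c], [choose] returns the same point of it. So [c] is injective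
    on the range of [r], which is therefore countable. *)
Lemma fibers_countable_representatives (Y : choiceType) (C : countType)
    (c : Y -> C) :
  exists2 D : set Y, countable D & forall y, exists2 z, D z & c z = c y.
Proof.
pose r y := choose (fun z => c z == c y) y.
have cr y : c (r y) = c y.
  by apply/eqP/(chooseP (P := fun z => c z == c y)).
exists (range r); last by move=> y; exists (r y); first exact: imageT.
apply/countable_injP; exists (pickle \o c) => _ _ /set_mem[y _ <-] /set_mem[z _ <-].
move=> /(pcan_inj pickleK); rewrite !cr => yz.
rewrite /r (@eq_choose _ _ (fun w => c w == c z)) => [|w]; last by rewrite yz.
by apply: choose_id; rewrite ?yz.
Qed.

Section seq_image_topology.
Context {R : realType} {T : Type} (phi : T -> nat -> R).
Context (phi1 : forall t, unit_seq (phi t)).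
Local Notation Y := (seq_image phi1).

Lemma seq_image_coord_continuous k : continuous (fun y : Y => val y k).
Proof.
move=> y; apply/(cvgrPdist_lt (FF := @nbhs_filter Y y)) => eps eps0.
apply/nbhs_ballP.
exists (eps / k.+1%:R); first by rewrite /= divr_gt0.
move=> z; rewrite ballEmdist /= => yz.
have := le_lt_trans (le_seq_dist k (seq_image_unit y) (seq_image_unit z)) yz.
by rewrite ltr_pM2r ?invr_gt0.
Qed.

Lemma separable_seq_image : separable Y.
Proof.
(* c n y lists the first n coordinates of y to precision 1/(n+1). *)
pose c n (y : Y) := [seq Num.truncn (val y k * n.+1%:R) | k <- iota 0 n].
have /(_ _)/cid2-/all_sig2[D cD cDP] n := fibers_countable_representatives (c n).
exists (\bigcup_n D n); first by apply: bigcup_countable.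
move=> O [y Oy]; rewrite openE => /(_ y Oy)/nbhs_ballP[eps /= eps0 yO].
have [n] := ltr_add_invr eps0; rewrite add0r => neps.
have [z Dz zy] := cDP n y.
exists z; split; last by exists n.
apply: yO; rewrite ballEmdist/=; apply: le_lt_trans neps.
apply: (seq_dist_le_prefix (seq_image_unit y) (seq_image_unit z) (lexx _)) => k kn.
(* Equal codes put both coordinates, scaled by [n+1], between the same two consecutive integers. *)
have : nth 0%N (c n z) k = nth 0%N (c n y) k by rewrite zy.
rewrite !(nth_map 0%N) ?size_iota// nth_iota// add0n => zyk.
have [/andP[y0 _] /andP[z0 _]] := (seq_image_unit y k, seq_image_unit z k).
have /andP[] := @truncn_itv R (val y k * n.+1%:R) (mulr_ge0 y0 (ler0n _ _)).
have /andP[] := @truncn_itv R (val z k * n.+1%:R) (mulr_ge0 z0 (ler0n _ _)).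
rewrite zyk -(natr1 (Num.truncn _)) => a b c' d.
have : `|(val y k - val z k) * n.+1%:R| <= 1.
  by rewrite mulrBl ler_norml; lra.
by rewrite normrM (ger0_norm (ler0n _ _)) -ler_pdivlMr ?ltr0n// mul1r.
Qed.

End seq_image_topology.

Definition to_seq_image {R : realType} (T : Type) (phi : T -> nat -> R)
    (phi1 : forall t, unit_seq (phi t)) (t : T) : seq_image phi1 :=
  SigSub (mem_set (imageT phi t)).

Lemma to_seq_image_continuous {R : realType} (T : topologicalType)
    (phi : T -> nat -> R) (phi1 : forall t, unit_seq (phi t)) :
  (forall k, continuous (phi ^~ k)) -> continuous (to_seq_image phi1).
Proof.
move=> cphi x; apply/cvg_ballP => eps eps0.
(* Half of [eps] turns the weak bound into the strict one that a ball requires. *)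
have := seq_dist_near x phi1 cphi (divr_gt0 eps0 (ltr0Sn R 1)).
apply: filterS => y xy; rewrite ballEmdist/=; apply: le_lt_trans xy _.
by rewrite ltr_pdivrMr// ltr_pMr// ltr1n.
Qed.

Lemma homeomorphism_id (T : topologicalType) : homeomorphism (@id T).
Proof.
split; last by rewrite image_id.
by split=> //; apply/seteqP; split=> [A oA|_ [A oA <-]//]; exists A.
Qed.

(** * From the Hurewicz property to G-delta sets *)

Lemma finite_set_nat_bounded (A : set nat) : finite_set A ->
  exists n, forall k, A k -> (k <= n)%N.
Proof.
move=> /finite_fsetP[F ->]; exists (\max_(i <- finmap.enum_fset F) i)%N => k kF.
exact: (@leq_bigmax_seq _ _ xpredT id k kF isT).
Qed.

(** For fixed [k] the sets [U k m] increase with [m], so the union of a finite subfamily lies in a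
    single one, whose index serves as [m k]. *)
Lemma projectively_hurewicz_lower_bounds (R : realType) (X : topologicalType)
    (g : nat -> X -> R) :
  projectively_hurewicz R X -> (forall k, continuous (g k)) ->
  (forall k x, 0 < g k x <= 1) ->
  exists m : nat -> nat, forall x, \forall k \near \oo, (m k).+1%:R^-1 < g k x.
Proof.
move=> pH cg g01.
have g1 x : unit_seq (g ^~ x) by move=> k; have /andP[/ltW-> ->] := g01 k x.
pose Y := seq_image g1.
pose U k m := [set y : Y | m.+1%:R^-1 < val y k].
have oU k m : open (U k m).
  have := @seq_image_coord_continuous _ _ _ g1 k; move/continuousP.
  by move=> /(_ _ (@open_gt R (m.+1%:R^-1))).
have covU k : open_cover (range (U k)).
  split; first by move=> _ [m _ <-].
  apply/seteqP; split=> // y _.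
  have /ltr_add_invr[m] : 0 < val y k.
    by have [x _ <-] := set_valP y; have /andP[] := g01 k x.
  by rewrite add0r => my; exists (U k m); first by exists m.
have metY : metrizable R Y by exists Y, id; exact: homeomorphism_id.
have rY : range (to_seq_image g1) = [set: Y].
  apply/seteqP; split=> // y _; have [x _ xy] := set_valP y.
  by exists x => //; exact: val_inj.
have [V [Vfin VP]] := pH Y _ (to_seq_image_continuous (phi1 := g1) cg) rY
  (separable_seq_image g1) metY _ covU.
have /(_ _)/cid-/all_sig[m mP] k :
    exists m, \bigcup_(A in V k) A `<=` U k m.
  have [finV VU] := Vfin k.
  (* The default 0 is taken only at sets outside the cover [range (U k)]. *)
  pose idx A := if pselect (exists m, U k m = A) is left h
    then projT1 (cid h) else 0%N.
  have idxP A : V k A -> U k (idx A) = A.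
    move=> /VU[m _ mA]; rewrite /idx; case: pselect => [h|[]]; last by exists m.
    exact: (projT2 (cid h)).
  have [n nP] := finite_set_nat_bounded (finite_image idx finV).
  exists n => y [A VA Ay]; rewrite /U/=.
  have : U k (idx A) y by rewrite idxP.
  apply: le_lt_trans; rewrite lef_pV2 ?posrE// ler_nat ltnS.
  by apply: nP; exists A.
exists m => x; apply: filterS (VP (to_seq_image g1 x)) => k.
exact: mP.
Qed.

Lemma Gdelta_of_projectively_hurewicz (R : realType) (X B : topologicalType)
    (e : X -> B) (F : set B) :
  continuous e -> projectively_hurewicz R X ->
  F `<=` ~` range e -> countable_union_of_zero_sets R F ->
  exists G : set B, [/\ Gdelta G, F `<=` G & G `<=` ~` range e].
Proof.
move=> ce pH Fe [Z [cZ Z0 FE]].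
(* Only a nonempty [Z] can be enumerated as [s 0, s 1, ...]; for empty [Z] the empty set serves as
   [G]. *)
have /pfcard_geP[Z_0|[s]] := cZ.
  exists set0; split=> //; last by rewrite FE Z_0 bigcup_set0.
  by apply: open_Gdelta; exact: open0.
have /(_ _)/cid-/all_sig[f fP] k : exists f : B -> R, [/\ continuous f,
    forall p, 0 <= f p <= 1 & s k = f @^-1` [set 0]].
  by apply: Z0; exact: ('funS_s I).
(* Keeping all earlier factors makes [g k] vanish on [s j] for every [k >= j], hence infinitely
   often at each point of [F]. *)
pose g k p := \prod_(i < k.+1) f i p.
have cg k : continuous (g k).
  rewrite /g; elim: k.+1 => [|n IHn].
    by under eq_fun do rewrite big_ord0; exact: cst_continuous.
  under eq_fun do rewrite big_ord_recr/=.
  by move=> p; apply: cvgM; [exact: IHn|have [+ _ _] := fP n; exact].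
have g01 k p : 0 <= g k p <= 1.
  have f01 i : 0 <= f i p <= 1 by have [_ + _] := fP i; exact.
  by rewrite prodr_ge0 ?prodr_ile1// => i _; have /andP[] := f01 i.
have g0 k j p : (j <= k)%N -> s j p -> g k p = 0.
  rewrite -ltnS => jk sp; rewrite /g (bigD1 (Ordinal jk))//=.
  by have [_ _ sE] := fP j; move: sp; rewrite sE => ->; rewrite mul0r.
have ge0 k x : 0 < g k (e x) <= 1.
  have /andP[g_ge0 ->] := g01 k (e x); rewrite andbT lt_neqAle g_ge0 andbT.
  rewrite eq_sym; apply/eqP => /eqP; rewrite prodf_seq_eq0 => /hasP[i _ /= /eqP fi].
  apply: (Fe (e x)); last by exists x.
  rewrite FE; exists (s i); first exact: ('funS_s I).
  by have [_ _ ->] := fP i.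
have cge k : continuous (g k \o e).
  by move=> x; apply: continuous_comp; [exact: ce|exact: cg].
have [m mP] := projectively_hurewicz_lower_bounds pH cge ge0.
exists (\bigcap_N (\bigcup_(k in [set k | (N <= k)%N]) [set p | g k p < (m k).+1%:R^-1])).
split.
- exists (fun N => \bigcup_(k in [set k | (N <= k)%N])
    [set p | g k p < (m k).+1%:R^-1]) => // N.
  apply: bigcup_open => k _; move/continuousP : (cg k).
  by move=> /(_ _ (@open_lt R ((m k).+1%:R^-1))).
- move=> p; rewrite FE => -[A ZA Ap] N _.
  have [j _ jA] := 'surj_s ZA.
  exists (maxn N j); first by rewrite /= leq_maxl.
  by rewrite /= (g0 _ j)//= ?leq_maxr ?jA ?invr_gt0.
- move=> p Gp [x _ xp]; move: Gp; rewrite -xp; have [N _ NP] := mP x.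
  by move=> /(_ N I)[k /= /NP/= /ltW]; rewrite leNgt => /negP.
Qed.

(** * From G-delta sets to the Hurewicz property *)

Lemma mdist_continuous (R : realType) (M : metricType R) (c : M) :
  continuous (mdist c).
Proof.
move=> y; apply/(cvgrPdist_lt (FF := @nbhs_filter M y)) => eps eps0.
apply/nbhs_ballP; exists eps => // z; rewrite ballEmdist /= => yz.
have := metric_triangle c y z; have := metric_triangle c z y.
by rewrite (metric_sym z y) ltr_norml; lra.
Qed.

(** The universal property asks for a compact target, so [g] is first corestricted to the unit
    interval. *)
Lemma stone_cech_unit_extension (R : realType) (X B : topologicalType)
    (e : X -> B) (g : X -> R) :
  stone_cech_compactification e -> continuous g -> (forall x, 0 <= g x <= 1) ->
  exists h : B -> R,
    [/\ continuous h, forall p, 0 <= h p <= 1 & forall x, h (e x) = g x].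
Proof.
move=> [_ _ _ _ ext] cg g01.
pose K : topologicalType := set_type (`[0, 1]%classic : set R).
have gK x : g x \in (`[0, 1]%classic : set R).
  by apply/mem_set; rewrite /= in_itv/= g01.
have cK : compact [set: K].
  apply: initial_compact.
  rewrite (_ : range _ = `[0, 1]%classic); first exact: segment_compact.
  apply/seteqP; split=> [_ [p _ <-]|p p01]; first exact: set_valP.
  by exists (SigSub (mem_set p01)).
have hK : hausdorff_space K.
  by apply: initial_hausdorff; [exact: Rhausdorff|exact: val_inj].
have cgK : continuous (fun x => SigSub (gK x) : K).
  by apply/continuousP => _ [A oA <-]; move/continuousP : cg; exact.
have [h ch he] := ext K _ cK hK cgK.
exists (fun p => set_val (h p)); split.
- move=> p; apply: (@continuous_comp _ K _ h set_val); first exact: ch.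
  exact: initial_continuous.
- by move=> p; have := set_valP (h p); rewrite /= in_itv.
- by move=> x; rewrite he.
Qed.

Lemma embedding_continuous (S T : topologicalType) (h : S -> T) :
  embedding h -> continuous h.
Proof. by move=> [oS _]; apply/continuousP => A oA; rewrite oS; exists A. Qed.

Lemma zero_set_setT (R : realType) (T : topologicalType) : zero_set R [set: T].
Proof.
exists (cst 0); split => [||]; first exact: cst_continuous.
- by move=> x; rewrite lexx ler01.
- by apply/seteqP; split.
Qed.

Lemma projectively_hurewicz_of_Gdelta (R : realType) (X B : topologicalType)
    (e : X -> B) :
  stone_cech_compactification e ->
  (forall F : set B,
    F `<=` ~` range e -> countable_union_of_zero_sets R F ->
    exists G : set B, [/\ Gdelta G, F `<=` G & G `<=` ~` range e]) ->
  projectively_hurewicz R X.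
Proof.
move=> eB FG Y f cf fY [D cD dD] [M [k hk]] U covU.
have [embk _] := hk; have ck := embedding_continuous embk.
have [openY _] := embk.
have ckf : continuous (k \o f).
  by move=> x; apply: continuous_comp; [exact: cf|exact: ck].
(* If the dense set is empty then so is [Y], and empty subfamilies suffice. *)
have /pfcard_geP[D0|[d]] := cD.
  exists (fun=> set0); split=> [n|y].
    by split; [exact: finite_set0|exact: sub0set].
  by have [||z []] := dD setT; [exists y|exact: (@openT Y)|rewrite D0].
have near_d y eps : 0 < eps -> exists i, mdist (k y) (k (d i)) < eps.
  move=> eps0.
  have [||z [yz Dz]] := dD [set z | mdist (k y) (k z) < eps].
  - by exists y; rewrite /= mdistxx.
  - have cyk : continuous (mdist (k y) \o k).
      move=> z; apply: continuous_comp; [exact: ck|exact: mdist_continuous].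
    by move/continuousP : cyk => /(_ _ (@open_lt R eps)).
  by have [i _ id] := 'surj_d Dz; exists i; rewrite id.
pose phi i j x : R := Num.max 0 (j.+1%:R^-1 - mdist (k (d i)) (k (f x))).
have phi01 i j x : 0 <= phi i j x <= 1.
  rewrite /phi le_max lexx/= ge_max ler01/= lerBlDr.
  by rewrite (@le_trans _ _ 1) ?lerDl ?mdist_ge0// invf_le1 ?ler1n.
have cphi i j : continuous (phi i j).
  move=> x; apply: (@continuous_max _ _ (cst 0)
    (fun x => j.+1%:R^-1 - mdist (k (d i)) (k (f x)))); first exact: cst_continuous.
  apply: cvgB; first exact: cvg_cst.
  by apply: (@continuous_comp _ M _ (k \o f)); [exact: ckf|exact: mdist_continuous].
have /(_ _)/cid-/all_sig[psi psiP] (ij : nat * nat) := stone_cech_unit_extension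
  eB (cphi ij.1 ij.2) (phi01 ij.1 ij.2).
pose good n ij := exists2 A, U n A &
  forall y, mdist (k (d ij.1)) (k y) < ij.2.+1%:R^-1 -> A y.
(* The value [setT] at the other pairs keeps this a countable intersection indexed by [nat],
   effectively over the good pairs only. *)
pose Z n := \bigcap_i \bigcap_j
  (if `[< good n (i, j) >] then psi (i, j) @^-1` [set 0] else setT).
have Z0 n : zero_set R (Z n).
  apply: zero_set_bigcap => i; apply: zero_set_bigcap => j.
  case: asboolP => _; last exact: zero_set_setT.
  by exists (psi (i, j)); have [] := psiP (i, j).
have ZX n : Z n `<=` ~` range e.
  move=> p Zp [x _ xp]; move: Zp; rewrite -{}xp => Zx.
  have [UO UT] := covU n.
  have [A UA Afx] : (\bigcup_(A in U n) A) (f x) by rewrite UT.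
  have := UO _ UA; rewrite openY => -[C oC CA].
  have /nbhs_ballP[eps /= eps0 epsC] : nbhs (k (f x)) C.
    by apply: open_nbhs_nbhs; split=> //; move: Afx; rewrite -CA.
  (* With [1/(j+1) < eps/2] and [d i] within [1/(j+1)] of [f x], the ball around [d i] contains
     [f x] and stays inside the [eps]-ball. So [(i, j)] is good and [psi (i, j)] is positive at
     [e x]. *)
  have [j] := ltr_add_invr (divr_gt0 eps0 (ltr0Sn R 1)); rewrite add0r => jeps.
  have [i di] := near_d (f x) _ (divr_gt0 ltr01 (ltr0Sn R j)).
  rewrite div1r metric_sym in di.
  have gij : good n (i, j).
    exists A => // y /= diy; rewrite -CA; apply: epsC; rewrite ballEmdist/=.
    apply: le_lt_trans (metric_triangle _ (k (d i)) _) _.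
    by rewrite (splitr eps) ltrD// ?(lt_trans _ jeps)// metric_sym.
  have := Zx i I j I; have [_ _ psie] := psiP (i, j).
  rewrite asboolT//= psie /phi/= => /eqP; rewrite eq_le ge_max lexx/=.
  by rewrite subr_le0 => /andP[+ _]; rewrite leNgt di.
have [||G [[W oW GW] FG' GX]] := FG (\bigcup_n Z n).
- by move=> p [n _]; exact: ZX.
- exists (range Z); split; first exact: (card_le_trans (card_image_le _ _)).
    by move=> _ [n _ <-].
  by rewrite bigcup_image.
(* The bound [n.+1] includes the index [n], so a point outside [W i] lies in [C n] for every
   [n >= i]. *)
pose C n := \bigcup_(i in `I_n.+1) ~` W i.
have cC n : compact (C n).
  have [cB _ _ _ _] := eB; apply: subclosed_compact cB (@subsetT _ _).
  by apply: closed_bigcup => // i _; exact: open_closedC.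
have CZ n p : C n p -> ~ Z n p.
  move=> [i _ Wip] Zp; apply: Wip; have : G p by apply: FG'; exists n.
  by rewrite GW; apply.
have /(_ _)/cid-/all_sig[E EP] n : exists E : set (nat * nat),
    [/\ finite_set E, E `<=` good n &
    forall p, C n p -> exists2 ij, E ij & 0 < psi ij p].
  (* Compactness is used as near-covering: each point has a neighbourhood on which [P N] holds for
     all large [N], so one [N] serves all of [C n]. Only finitely many pairs have a code at most
     [N]. *)
  pose P N p := exists2 ij, good n ij /\ (pickle ij <= N)%N & 0 < psi ij p.
  have [|N _ /(_ N (leqnn N)) NP] := (compact_near_coveringP _).1 (cC n) nat \oo P _.
    move=> p /CZ Zp.
    have [ij gij psi0] : exists2 ij, good n ij & 0 < psi ij p.
      apply: contrapT => np; apply: Zp => i _ j _.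
      case: asboolP => //= gij; apply: contrapT => /eqP psi0; apply: np.
      exists (i, j) => //; have [_ + _] := psiP (i, j).
      by move=> /(_ p)/andP[+ _]; rewrite lt_neqAle eq_sym psi0.
    exists ([set q | 0 < psi ij q], [set N | (pickle ij <= N)%N]) => /=.
      split; last by exists (pickle ij).
      have [cpsi _ _] := psiP ij; apply: open_nbhs_nbhs; split=> //.
      by move/continuousP : cpsi => /(_ _ (@open_gt R 0)).
    by move=> [q N] [/= q0 ijN]; exists ij.
  exists [set ij | good n ij /\ (pickle ij <= N)%N]; split=> // [|ij []//].
  apply: (@sub_finite_set _ _ (pickle @^-1` `I_N.+1)) => [ij []//|].
  apply: finite_preimage (finite_II _) => ij ij' _ _.
  exact: (pcan_inj pickleK).
(* The default [setT] is taken only at pairs that are not good, and these do not occur in [E n]. *)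
pose A n ij := if pselect (good n ij) is left h then s2val (cid2 h) else setT.
have AP n ij : good n ij -> U n (A n ij) /\
    forall y, mdist (k (d ij.1)) (k y) < ij.2.+1%:R^-1 -> A n ij y.
  move=> h; rewrite /A; case: pselect => // h'; split.
    exact: (s2valP (cid2 h')).
  exact: (s2valP' (cid2 h')).
exists (fun n => A n @` E n); split=> [n|y].
  have [finE Eg _] := EP n; split; first exact: finite_image.
  by move=> _ [ij /Eg/AP[UA _] <-].
have [x _ xy] : range f y by rewrite fY.
have [i Wi] : exists i, ~ W i (e x).
  apply/existsNP => Wx; apply: (GX (e x)); last by exists x.
  by rewrite GW => i _.
exists i => // n /= le_in.
have [_ Eg EC] := EP n.
have [ij ijE] := EC (e x) (ex_intro2 _ _ i le_in Wi).
have [_ _ ->] := psiP ij; rewrite /phi lt_max ltxx/= subr_gt0 xy => ijy.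
exists (A n ij); first by exists ij.
by have [_] := AP n ij (Eg _ ijE); exact.
Qed.

Theorem theorem3p3 (R : realType) (X bX : topologicalType) (e : X -> bX)
    (hX : tychonoff_space X) (hbX : stone_cech_compactification e) :
  projectively_hurewicz R X <->
  (forall F : set bX,
    F `<=` ~` range e -> countable_union_of_zero_sets R F ->
    exists G : set bX, [/\ Gdelta G, F `<=` G & G `<=` ~` range e]).
Proof.
split=> [pH F FX FZ|]; last exact: projectively_hurewicz_of_Gdelta.
have [_ _ embe _ _] := hbX.
exact: Gdelta_of_projectively_hurewicz (embedding_continuous embe) pH FX FZ.
Qed.
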